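(* Let $\mathbb{D}$ be a skew field, $d\ge 2$, and let $(V,\mathcal{P},\mathcal{B})$ be a $\mathrm{TD}(3,n)$ with transversal point $\infty$, properly embedded on three hyperplanes $H_1,H_2,H_3$ of $P^d(\mathbb{D})$. Then $\dim(H_1\cap H_2\cap H_3)=d-2$, and if adapted homogeneous coordinates are chosen, with $G$ the subgroup of $(\mathbb{D}^{d-1},+)$ associated with the embedding, then $\infty=[\boldsymbol{\gamma},a,1]$ for some $\boldsymbol{\gamma}\in G$ and $a\in\mathbb{D}_G\setminus\{0,1\}$. Conversely, any point $[\boldsymbol{\gamma},a,1]$ with $\boldsymbol{\gamma}\in G$ and $a\in\mathbb{D}_G\setminus\{0,1\}$ is a transversal point. In particular, a transversal point lies on a hyperplane with equation $x_d=ax_{d+1}$ for some $a\in\mathbb{D}_G\setminus\{0,1\}$. Moreover, a $\mathrm{TD}(3,n)$ embedded on three hyperplanes of $P^d(\mathbb{D})$ that intersect in a $(d-2)$-flat, with associated group $G$, has a transversal point if and only if $|\mathbb{D}_G|\ge 3$.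
   Context: A transversal design $\mathrm{TD}(k,n)$, with $n\ge 3$, $k\ge 3$, is a triple $(V,\mathcal{P},\mathcal{B})$ where $V$ is a set of size $kn$, $\mathcal{P}$ is a partition of $V$ into $k$ subsets of size $n$ (called parts), and $\mathcal{B}$ is a set of $k$-subsets of $V$ (called blocks), such that any two distinct elements of $V$ are contained in either a unique part or a unique block, but not both. (A Latin square of side $n$ is equivalent to a $\mathrm{TD}(3,n)$.) For a skew field $\mathbb{D}$, $\mathbb{D}^{m}$ is regarded as a right vector space: $(x_1,\dots,x_m)\alpha=(x_1\alpha,\dots,x_m\alpha)$. $P^d(\mathbb{D})$ is the $d$-dimensional projective space of one-dimensional subspaces of the right vector space $\mathbb{D}^{d+1}$; $[x_1,\dots,x_{d+1}]$ denotes the point with those homogeneous coordinates (with respect to some basis of $\mathbb{D}^{d+1}$). Here $[\boldsymbol{x},y,z]$ has $\boldsymbol{x}\in\mathbb{D}^{d-1}$, $y,z\in\mathbb{D}$, and $\boldsymbol{o}$ is the zero vector of $\mathbb{D}^{d-1}$. Hyperplanes are $(d-1)$-flats, with equations $\alpha_1x_1+\dots+\alpha_{d+1}x_{d+1}=0$, not all $\alpha_i=0$. Dimension is projective dimension. A $\mathrm{TD}(3,n)$ $(V,\mathcal{P},\mathcal{B})$ is embedded on the hyperplanes $H_1,H_2,H_3$ of $P^d(\mathbb{D})$ if $V\subseteq P^d(\mathbb{D})$, the hyperplanes $H_i$ are distinct, $\mathcal{P}=\{V\cap H_1,V\cap H_2,V\cap H_3\}$, every block $B$ is contained in a line $\ell_B$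 of $P^d(\mathbb{D})$, the lines $\ell_B$ ($B\in\mathcal{B}$) are distinct, and no $\ell_B$ is contained in any $H_i$. The embedding is proper if $V$ does not lie on a hyperplane. A transversal point of the embedded $\mathrm{TD}(3,n)$ is a point $\infty\in P^d(\mathbb{D})$ for which there is a partition of $V$ into $n$ pairwise disjoint blocks $B_1,\dots,B_n$ such that the lines $\ell_{B_1},\dots,\ell_{B_n}$ all pass through $\infty$. When $\dim(H_1\cap H_2\cap H_3)=d-2$, adapted homogeneous coordinates are obtained as follows: choose $1_1\in H_1\cap V$, $1_2\in H_2\cap V$, let $1_3$ be the point of $H_3\cap V$ on the block through $1_1,1_2$, and choose homogeneous coordinates with $H_1\cap H_2\cap H_3=\{[\boldsymbol{x},0,0]:\boldsymbol{x}\in\mathbb{D}^{d-1}\}$, $1_1=[\boldsymbol{o},0,1]$, $1_2=[\boldsymbol{o},1,1]$, $1_3=[\boldsymbol{o},1,0]$; then $H_1,H_2,H_3$ have equations $x_d=0$, $x_d=x_{d+1}$, $x_{d+1}=0$. The group associated with the embedding (in these coordinates) is the subgroup $G$ of $(\mathbb{D}^{d-1},+)$ of order $n$ such that $H_1\cap V=\{[\boldsymbol{\gamma},0,1]:\boldsymbol{\gamma}\in G\}$, $H_2\cap V=\{[\boldsymbol{\gamma},1,1]:\boldsymbol{\gamma}\in G\}$, $H_3\cap V=\{[-\boldsymbol{\gamma},1,0]:\boldsymbol{\gamma}\in G\}$ (such a subgroup always exists). For a finite subgroup $G$ of $(\mathbb{D}^{d-1},+)$, $\mathbb{D}_G=\{a\in\mathbb{D}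 : Ga\subseteq G\}$, which is a subfield of $\mathbb{D}$ when $G$ is nontrivial. *)

(* Defs.v *)
(* MathComp, with the classical sets of MathComp-Analysis. *)
From mathcomp Require Import all_boot all_order all_algebra.
From mathcomp Require Import boolp classical_sets functions cardinality.

Set Implicit Arguments.
Unset Strict Implicit.
Unset Printing Implicit Defensive.

Import GRing.Theory.
Local Open Scope classical_set_scope.
Local Open Scope card_scope.
Local Open Scope ring_scope.

(* TD(k, n) on the set V, with parts P and blocks B. *)
Record transversal_design (T : Type) (k n : nat)
    (V : set T) (P B : set (set T)) : Prop := TransversalDesign {
  td_k : (3 <= k)%N;
  td_n : (3 <= n)%N;
  td_card : V #= `I_(k * n);
  td_partition : partition P id V;
  td_card_parts : P #= `I_k;
  td_card_part : forall X, P X -> X #= `I_n;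
  td_block : forall b, B b -> b `<=` V /\ b #= `I_k;
  td_pair : forall x y, V x -> V y -> x <> y ->
    let on X := X x /\ X y in
    ((exists! X, P X /\ on X) /\ ~ (exists2 b, B b & on b)) \/
    ((exists! b, B b /\ on b) /\ ~ (exists2 X, P X & on X)) }.

(* D ^ m is 'cV[D]_m with scalars on the right.  For A : 'M[D]_(m, r), the map
   c |-> A *m c is right linear: A *m c is the right linear combination, with
   coefficients c, of the columns of A. *)
Section RightProjectiveSpace.
Variable D : unitRingType.

Definition rscale m (v : 'cV[D]_m) (a : D) : 'cV[D]_m := \col_i (v i 0 * a).

Definition rfree m r (A : 'M[D]_(m, r)) : Prop :=
  forall c : 'cV[D]_r, A *m c = 0 -> c = 0.

Definition rspan m r (A : 'M[D]_(m, r)) : set 'cV[D]_m :=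
  [set A *m c | c in [set: 'cV[D]_r]].

Definition rbasis m (M : 'M[D]_m) : Prop := rfree M /\ rspan M = setT.

(* A point of P^d(D) is a one-dimensional subspace of D ^ (d + 1), as a set of
   vectors; V, lines, hyperplanes are sets of points. *)
Definition pspace d := set 'cV[D]_d.+1.

Definition ray d (v : 'cV[D]_d.+1) : pspace d :=
  [set rscale v a | a in [set: D]].

Definition points d : set (pspace d) :=
  [set p | exists2 v, v != 0 & p = ray v].

(* F is a flat of projective dimension r. *)
Definition flat d (r : nat) (F : set (pspace d)) : Prop :=
  exists A : 'M[D]_(d.+1, r.+1),
    rfree A /\ F = [set p | points p /\ p `<=` rspan A].

Definition line d (F : set (pspace d)) : Prop := flat 1 F.
Definition hyperplane d (F : set (pspace d)) : Prop := flat d.-1 F.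

Section Embedding.
Variables d n : nat.
Variables (V : set (pspace d)) (P B : set (set (pspace d))).
(* ell b is the line spanned by the block b. *)
Variable ell : set (pspace d) -> set (pspace d).
Variables H1 H2 H3 : set (pspace d).

Record embedded : Prop := Embedded {
  emb_points : V `<=` @points d;
  emb_hyperplane : [/\ hyperplane H1, hyperplane H2 & hyperplane H3];
  emb_distinct : [/\ H1 <> H2, H1 <> H3 & H2 <> H3];
  emb_parts : P = [set V `&` H1; V `&` H2; V `&` H3];
  emb_line : forall b, B b -> line (ell b) /\ b `<=` ell b;
  emb_line_distinct : set_inj B ell;
  emb_line_notin : forall b, B b ->
    [/\ ~ (ell b `<=` H1), ~ (ell b `<=` H2) & ~ (ell b `<=` H3)] }.

Definition proper_embedding : Prop := ~ exists H, hyperplane H /\ V `<=` H.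

Definition transversal_point (q : pspace d) : Prop :=
  points q /\
  exists C : set (set (pspace d)),
    [/\ C `<=` B, C #= `I_n, partition C id V & forall b, C b -> ell b q].

(* The column (x, y, z) of D ^ (d + 1), for x in D ^ (d - 1); meant for
   0 < d. *)
Definition cvec3 (x : 'cV[D]_d.-1) (y z : D) : 'cV[D]_d.+1 :=
  \col_(i < d.+1)
    if insub (val i) is Some j then x j 0
    else if val i == d.-1 then y else z.

(* [x, y, z] in homogeneous coordinates with respect to the basis formed by
   the columns of M; it is a point as soon as (x, y, z) is not zero. *)
Definition hcoord (M : 'M[D]_d.+1) x y z : pspace d := ray (M *m cvec3 x y z).

(* The hyperplane x_d = a x_{d+1}. *)
Definition hyperplane_ratio (M : 'M[D]_d.+1) (a : D) : set (pspace d) :=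
  [set p | points p /\ exists x y z, p = hcoord M x y z /\ y = a * z].

Definition adapted (M : 'M[D]_d.+1) : Prop :=
  [/\ rbasis M,
      H1 `&` H2 `&` H3 = [set p | points p /\ exists x, p = hcoord M x 0 0]
    & exists p1 p2 p3 b,
      [/\ [/\ (H1 `&` V) p1, (H2 `&` V) p2 & (H3 `&` V) p3],
          [/\ B b, b p1, b p2 & b p3]
        & [/\ p1 = hcoord M 0 0 1, p2 = hcoord M 0 1 1
            & p3 = hcoord M 0 1 0]]].

Record associated_group (M : 'M[D]_d.+1) (G : set 'cV[D]_d.-1) : Prop :=
  AssociatedGroup {
  ag_subgroup : zmod_closed (mem G);
  ag_order : G #= `I_n;
  ag_H1 : H1 `&` V = [set hcoord M g 0 1 | g in G];
  ag_H2 : H2 `&` V = [set hcoord M g 1 1 | g in G];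
  ag_H3 : H3 `&` V = [set hcoord M (- g) 1 0 | g in G] }.

End Embedding.

Definition stabilizer_field m (G : set 'cV[D]_m) : set D :=
  [set a | forall g, G g -> G (rscale g a)].

End RightProjectiveSpace.

(* Main.v *)
(** Each hyperplane H_i is the zero set of a linear form f_i.  A transversal
    point w lies on no H_i, so f_i(w) = 1 may be assumed; let T be the set of
    values of f_2 / f_3 on V ∩ H_1.  Following blocks through two points and
    lines through w around the triangle shows that T, a finite subset of
    D \ {0, 1}, is closed under (s, t) |-> s (1 - 1/t) + 1.  This forces T to be
    a singleton {t}: for u = 1 - 1/t the maps s |-> s u + 1 permute T, so, if
    |T| > 1, comparing sums gives |T| = 0 in D; on the other hand the group of right
    multiplications preserving T is simply transitive on T, so by Cauchy it has
    an element of order p = char D, impossible as x^p = 1 implies x = 1.  Hence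
    V lies in the zero set of (t - 1) f_1 + f_2 - t f_3, and properness makes
    the f_i dependent.

    In adapted coordinates, if [x, a, 1] is transversal then the lines joining
    it to [g, 0, 1] give x - g in G a for all g in G; comparing cardinalities,
    x in G and G a = G.  Conversely the blocks whose lines pass through
    [g, a, 1] partition V, since two points of a line determine it. *)
Require Import Defs.
From mathcomp Require Import all_boot all_order all_algebra.
From mathcomp Require Import fingroup perm pgroup.
From mathcomp Require Import boolp classical_sets functions cardinality.

Set Implicit Arguments.
Unset Strict Implicit.
Unset Printing Implicit Defensive.

Import GRing.Theory.
Local Open Scope classical_set_scope.
Local Open Scope card_scope.
Local Open Scope ring_scope.

(** * Finite sets of ratios in a skew field *)

Section SkewField.
Variable D : unitRingType.
Hypothesis D_field : GRing.field_axiom D.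

Lemma skew_mulf_eq0 (x y : D) : (x * y == 0) = (x == 0) || (y == 0).
Proof.
apply/eqP/orP => [xy0|[]/eqP->]; rewrite ?mul0r ?mulr0 //.
case: (eqVneq x 0) => [|/D_field ux]; [by left | right].
by rewrite -(mulKr ux y) xy0 mulr0.
Qed.

Lemma skew_mulIf (a : D) : a != 0 -> injective (fun x => x * a).
Proof. by move=> /D_field ua; apply: mulIr. Qed.

Lemma skew_mulfI (a : D) : a != 0 -> injective (fun x => a * x).
Proof. by move=> /D_field ua; apply: mulrI. Qed.

(** Without zero divisors, splitting off the smallest prime factor of [m] makes either that prime or
    the cofactor vanish in [D]; induction treats the cofactor. *)
Lemma skew_natr_eq0_prime (m : nat) : (0 < m)%N -> m%:R = 0 :> D ->
  exists2 p, prime p & (p %| m)%N /\ p%:R = 0 :> D.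
Proof.
elim/ltn_ind: m => m IH m_gt0 m0.
case: (leqP m 1) => [m_le1|m_gt1].
  have m1 : m = 1%N by apply/eqP; rewrite eqn_leq m_le1.
  by move/eqP: m0; rewrite m1 oner_eq0.
have /dvdnP[k mE] := pdiv_dvd m.
have /eqP := m0; rewrite mE natrM skew_mulf_eq0 => /orP[] /eqP k0; last first.
  by exists (pdiv m); [apply: pdiv_prime | rewrite -mE pdiv_dvd].
have k_gt0 : (0 < k)%N by move: m_gt0; rewrite mE muln_gt0 => /andP[].
have k_lt : (k < m)%N.
  by rewrite [ltnRHS]mE ltn_Pmulr // prime_gt1 // pdiv_prime.
have [p pp [pk p0]] := IH k k_lt k_gt0 k0.
by exists p => //; split=> //; apply: dvdn_mulr.
Qed.

(** As [x] commutes with [1], Frobenius gives (x - 1)^p = x^p - 1 = 0, and a skew field has no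
    nonzero nilpotents. *)
Lemma skew_expr_eq1 (p : nat) (x : D) :
  prime p -> p%:R = 0 :> D -> x ^+ p = 1 -> x = 1.
Proof.
move=> pp p0 xp; have chp : p \in [pchar D] by rewrite inE pp p0 eqxx.
have := pFrobenius_autB_comm chp (commr1 x).
rewrite !pFrobenius_autE expr1n xp subrr => /eqP.
have E0 (y : D) k : y ^+ k = 0 -> y = 0.
  elim: k => [|k IH]; first by move/eqP; rewrite expr0 oner_eq0.
  by move/eqP; rewrite exprS skew_mulf_eq0 => /orP[/eqP|/eqP/IH].
by move=> /eqP/E0/subr0_eq.
Qed.

(** * A finite set closed under the affine maps has at most one element *)

Section Ratios.
Variable s : seq D.
Hypotheses (s_uniq : uniq s) (s0 : 0 \notin s) (s1 : 1 \notin s).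
Hypothesis s_closed :
  forall y z, y \in s -> z \in s -> y * (1 - z^-1) + 1 \in s.

Let sn0 x : x \in s -> x != 0.
Proof. by apply: contraTneq => ->. Qed.

Let u (z : D) := 1 - z^-1.

Let u_inj : injective u.
Proof. by move=> z z' /addrI /oppr_inj /invr_inj. Qed.

Let un0 z : z \in s -> u z != 0.
Proof.
move=> zs; rewrite subr_eq0; apply: contraNneq s1 => z1.
by move: zs; rewrite -[z]invrK -z1 invr1.
Qed.

Let affine_perm z : z \in s -> perm_eq [seq y * u z + 1 | y <- s] s.
Proof.
move=> zs.
have inj : injective (fun y => y * u z + 1).
  by move=> x y /addIr; apply: skew_mulIf; apply: un0.
have U : uniq [seq y * u z + 1 | y <- s] by rewrite map_inj_uniq.
apply: uniq_perm => //.
have [] // := uniq_min_size U (s2 := s).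
  by move=> _ /mapP[y ys ->]; apply: s_closed.
by rewrite size_map.
Qed.

(** Let S be the sum of [s]. The affine permutation given by x yields S = S u(x) + |s|. Two
    different choices of x force S = 0, because [u] is injective, and then |s| = 0 in [D]. *)
Lemma ratios_natr_eq0 : (1 < size s)%N -> (size s)%:R = 0 :> D.
Proof.
case sE: {1}s => [|y [|z r]] // _.
have ys : y \in s by rewrite sE mem_head.
have zs : z \in s by rewrite sE !inE eqxx orbT.
have sumE x : x \in s ->
    \sum_(t <- s) t = (\sum_(t <- s) t) * u x + (size s)%:R.
  move=> xs; rewrite -[LHS](perm_big _ (affine_perm xs)) big_map big_split /=.
  by rewrite -mulr_suml big_const_seq count_predT iter_addr_0.
have := sumE _ ys; rewrite {1}(sumE _ zs) => /addIr /eqP.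
rewrite -subr_eq0 -mulrBr skew_mulf_eq0 => /orP[/eqP S0|]; last first.
  rewrite subr_eq0 (inj_eq u_inj) => /eqP zy.
  by move: s_uniq; rewrite sE /= zy mem_head.
by have := sumE _ ys; rewrite S0 mul0r add0r.
Qed.

Let S := seq_sub s.

(** The right multiplications preserving [s], realised as permutations so that Cauchy's theorem for
    finite groups applies. *)
Let stab : {set {perm S}} :=
  [set g : {perm S} | `[< exists k, forall x, val (g x) = val x * k >]]%SET.

Let stab_group : group_set stab.
Proof.
apply/group_setP; split.
  by rewrite finset.inE; apply/asboolP; exists 1 => x; rewrite perm1 mulr1.
move=> g h; rewrite !finset.inE => /asboolP[k gk] /asboolP[l hl].
by apply/asboolP; exists (k * l)%R; move=> x; rewrite permM hl gk mulrA.
Qed.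

Lemma ratios_size_le1 : (size s <= 1)%N.
Proof.
case: leqP => // s_gt1.
have s_gt0 : (0 < size s)%N by apply: ltnW.
have [p pp [ps p0]] := skew_natr_eq0_prime s_gt0 (ratios_natr_eq0 s_gt1).
have [t ts] : exists t, t \in s.
  by case: (s) s_gt0 => // t r _; exists t; apply: mem_head.
(* [x * u z + 1] lies in [s], hence equals [x' * u t + 1] with [x'] in [s]; cancelling,
   multiplication by [u z / u t] sends [x] to [x']. *)
have shift_in z (zs : z \in s) (x : S) : val x * (u z / u t) \in s.
  have : val x * u z + 1 \in s by apply: s_closed => //; apply: valP.
  rewrite -(perm_mem (affine_perm ts)) => /mapP[x' x's /addIr xE].
  by rewrite mulrA xE mulrK //; apply/D_field/un0.
pose mulS z (zs : z \in s) x : S := SeqSub (shift_in z zs x).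
have mulS_inj z (zs : z \in s) : injective (mulS z zs).
  move=> x y /(congr1 val) /= E; apply: val_inj; apply: skew_mulIf E.
  by rewrite skew_mulf_eq0 invr_eq0 negb_or !un0.
pose g (z : S) : {perm S} := perm (mulS_inj _ (valP z)).
have g_inj : injective g.
  move=> z z' /permP /(_ (SeqSub ts)) /(congr1 val).
  rewrite !permE /= => /(skew_mulfI (sn0 ts)) E.
  apply: val_inj; apply: u_inj; apply: skew_mulIf E.
  by rewrite invr_eq0 un0.
pose G := Group stab_group.
have cardG : #|G| = size s.
  (* Upper bound: the image of [t] determines the multiplier, hence the permutation. Lower bound:
     the permutations [g z] are |s| distinct members. *)
  rewrite -(card_seq_sub s_uniq); apply/eqP; rewrite eqn_leq; apply/andP; split.
    pose ev (h : {perm S}) := h (SeqSub ts).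
    rewrite -(card_in_imset (f := ev)); first exact: max_card.
    move=> h h'; rewrite !finset.inE => /asboolP[k hk] /asboolP[l hl] /(congr1 val).
    rewrite /ev hk hl => /(skew_mulfI (sn0 ts)) kl.
    by apply/permP => x; apply: val_inj; rewrite hk hl kl.
  rewrite -(card_imset predT g_inj); apply/subset_leq_card/fintype.subsetP.
  move=> _ /imsetP[z _ ->]; rewrite finset.inE; apply/asboolP.
  by exists (u (val z) / u t) => x; rewrite permE.
have [h hG ho] : {h | h \in G & #[h]%g = p} by apply: Cauchy; rewrite ?cardG.
move: hG; rewrite finset.inE => /asboolP[k hk].
have hX n x : val ((h ^+ n)%g x) = val x * k ^+ n.
  elim: n => [|n IH]; first by rewrite perm1 mulr1.
  by rewrite expgSr permM hk IH exprSr mulrA.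
have kp : k ^+ p = 1.
  apply: (skew_mulfI (sn0 ts)); rewrite mulr1 -[t in LHS]/(val (SeqSub ts)) -hX.
  by rewrite -ho expg_order perm1.
have k1 := skew_expr_eq1 pp p0 kp.
have h1 : h = 1%g.
  by apply/permP => x; apply: val_inj; rewrite hk perm1 k1 mulr1.
by move: pp; rewrite -ho h1 order1.
Qed.

End Ratios.
End SkewField.

(** * Right linear algebra and flats *)

Section RightLinearAlgebra.
Variable D : unitRingType.
Hypothesis D_field : GRing.field_axiom D.

Lemma rscaleE m (v : 'cV[D]_m) a : rscale v a = v *m a%:M.
Proof. by apply/colP => i; rewrite !mxE big_ord1 !mxE mulr1n. Qed.

Lemma mulmx_rscale m r (A : 'M[D]_(m, r)) v a :
  A *m rscale v a = rscale (A *m v) a.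
Proof. by rewrite !rscaleE mulmxA. Qed.

Lemma rscaleDl m (v w : 'cV[D]_m) a : rscale (v + w) a = rscale v a + rscale w a.
Proof. by rewrite !rscaleE mulmxDl. Qed.

Lemma rscaleDr m (v : 'cV[D]_m) a b : rscale v (a + b) = rscale v a + rscale v b.
Proof. by apply/colP => i; rewrite !mxE mulrDr. Qed.

Lemma rscaleNl m (v : 'cV[D]_m) a : rscale (- v) a = - rscale v a.
Proof. by rewrite !rscaleE mulNmx. Qed.

Lemma rscaleNr m (v : 'cV[D]_m) a : rscale v (- a) = - rscale v a.
Proof. by apply/colP => i; rewrite !mxE mulrN. Qed.

Lemma rscaleA m (v : 'cV[D]_m) a b : rscale (rscale v a) b = rscale v (a * b).
Proof. by apply/colP => i; rewrite !mxE mulrA. Qed.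

Lemma rscale1 m (v : 'cV[D]_m) : rscale v 1 = v.
Proof. by apply/colP => i; rewrite !mxE mulr1. Qed.

Lemma rscale0 m (v : 'cV[D]_m) : rscale v 0 = 0.
Proof. by apply/colP => i; rewrite !mxE mulr0. Qed.

Lemma rscale0l m a : rscale (0 : 'cV[D]_m) a = 0.
Proof. by apply/colP => i; rewrite !mxE mul0r. Qed.

Lemma rscaleK m (v : 'cV[D]_m) a : a != 0 -> rscale (rscale v a) a^-1 = v.
Proof. by move=> /D_field ua; rewrite rscaleA divrr ?rscale1. Qed.

Lemma rscaleVK m (v : 'cV[D]_m) a : a != 0 -> rscale (rscale v a^-1) a = v.
Proof. by move=> /D_field ua; rewrite rscaleA mulVr ?rscale1. Qed.

Lemma rscale_inj m a : a != 0 -> injective (fun v : 'cV[D]_m => rscale v a).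
Proof. by move=> a0 v w /(congr1 (fun u => rscale u a^-1)); rewrite !rscaleK. Qed.

Lemma rscale_eq0 m (v : 'cV[D]_m) a : (rscale v a == 0) = (v == 0) || (a == 0).
Proof.
have [->|a0] := eqVneq a 0; first by rewrite rscale0 eqxx orbT.
by rewrite orbF -[0 in LHS](rscale0l _ a) (inj_eq (rscale_inj a0)).
Qed.

Lemma cV_neq0 m (b : 'cV[D]_m) : b != 0 -> exists j, b j 0 != 0.
Proof.
move=> b0; apply: contrapT => nb; case/eqP: b0; apply/colP => j; rewrite mxE.
by apply/eqP; apply: contraPT isT => bj _; apply: nb; exists j.
Qed.

Lemma rV_neq0 m (f : 'rV[D]_m) : f != 0 -> exists j, f 0 j != 0.
Proof.
move=> f0; apply: contrapT => nf; case/eqP: f0; apply/rowP => j; rewrite mxE.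
by apply/eqP; apply: contraPT isT => fj _; apply: nf; exists j.
Qed.

(** * Linear forms, their kernels, and equations of spans *)

Definition lform m (f : 'rV[D]_m) (v : 'cV[D]_m) : D := (f *m v) 0 0.

Lemma lformD m (f : 'rV[D]_m) v w : lform f (v + w) = lform f v + lform f w.
Proof. by rewrite /lform mulmxDr mxE. Qed.

Lemma lformN m (f : 'rV[D]_m) v : lform f (- v) = - lform f v.
Proof. by rewrite /lform mulmxN mxE. Qed.

Lemma lformB m (f : 'rV[D]_m) v w : lform f (v - w) = lform f v - lform f w.
Proof. by rewrite lformD lformN. Qed.

Lemma lformZ m (f : 'rV[D]_m) v a : lform f (rscale v a) = lform f v * a.
Proof. by rewrite /lform mulmx_rscale mxE. Qed.

Lemma lformDl m (f g : 'rV[D]_m) v : lform (f + g) v = lform f v + lform g v.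
Proof. by rewrite /lform mulmxDl mxE. Qed.

Lemma lformNl m (f : 'rV[D]_m) v : lform (- f) v = - lform f v.
Proof. by rewrite /lform mulNmx mxE. Qed.

Lemma lformZl m (f : 'rV[D]_m) v a : lform (a *: f) v = a * lform f v.
Proof. by rewrite /lform -scalemxAl mxE. Qed.

Lemma lform0l m v : lform (0 : 'rV[D]_m) v = 0.
Proof. by rewrite /lform mul0mx mxE. Qed.

Lemma lform_neq0_vec m (f : 'rV[D]_m) v : lform f v != 0 -> v != 0.
Proof. by apply: contra_neq => ->; rewrite /lform mulmx0 mxE. Qed.

Lemma lform_eq0 m (f : 'rV[D]_m) v : f *m v = 0 <-> lform f v = 0.
Proof.
rewrite /lform; split=> [-> | f0]; first by rewrite mxE.
by apply/rowP => i; rewrite ord1 f0 mxE.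
Qed.

Lemma lform_eq1_exists m (f : 'rV[D]_m) : f != 0 -> exists v, lform f v = 1.
Proof.
move=> /rV_neq0[j fj].
exists (rscale (delta_mx j 0) (f 0 j)^-1).
by rewrite lformZ /lform -colE mxE divrr //; apply: D_field.
Qed.

(** [S] subtracts from [x] the right multiple of [b] that clears a coordinate [j] with [b j 0]
    nonzero, then drops that coordinate; exactly the multiples of [b] are killed. *)
Lemma project_along s (b : 'cV[D]_s.+1) : b != 0 ->
  exists S : 'M[D]_(s, s.+1), (forall y : 'cV_s, exists v, S *m v = y) /\
    forall x : 'cV_s.+1, S *m x = 0 <-> exists a, x = rscale b a.
Proof.
move=> /cV_neq0[j bj].
pose c := \col_k (b (lift j k) 0 / b j 0).
pose S := row' j 1%:M - c *m delta_mx 0 j : 'M[D]_(s, s.+1).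
have SE (x : 'cV_s.+1) k : (S *m x) k 0 = x (lift j k) 0 - c k 0 * x j 0.
  rewrite mulmxBl -mulmxA -rowE row'Esub -rowsubE.
  by rewrite !mxE big_ord1 !mxE.
exists S; split=> [y|x].
  exists (\col_i if unlift j i is Some k then y k 0 else 0).
  by apply/colP => k; rewrite SE !mxE liftK unlift_none mulr0 subr0.
split=> [Sx|[a ->]]; last first.
  by apply/colP => k; rewrite SE !mxE mulrA divrK ?subrr //; apply: D_field.
exists ((b j 0)^-1 * x j 0); apply/colP => i; rewrite !mxE.
case: (unliftP j i) => [k|] ->; last first.
  by rewrite mulrA divrr ?mul1r //; apply: D_field.
have := SE x k; rewrite Sx !mxE => /esym/eqP; rewrite subr_eq0 => /eqP ->.
by rewrite mulrA.
Qed.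

(** The equation is solved for a coordinate [j] with nonzero coefficient: the other coordinates are
    free, and [N] fills in the [j]-th one. *)
Lemma ker_lform m (f : 'rV[D]_m.+1) : f != 0 ->
  exists N : 'M[D]_(m.+1, m), rfree N /\ forall v, lform f v = 0 <-> rspan N v.
Proof.
move=> /rV_neq0[j fj].
have uj := D_field fj.
pose g := \row_k ((f 0 j)^-1 * f 0 (lift j k)).
pose N := col' j 1%:M - delta_mx j 0 *m g : 'M[D]_(m.+1, m).
have lformE v : lform f v = f 0 j * (v j 0 + lform g (row' j v)).
  rewrite /lform mxE (bigD1_ord j) //= mulrDr mxE mulr_sumr; congr (_ + _).
  by apply: eq_bigr => k _; rewrite !mxE mulrA mulVKr.
have NE (c : 'cV_m) i : (N *m c) i 0 =
    if unlift j i is Some k then c k 0 else - lform g c.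
  rewrite mulmxBl -mulmxA mxE; case: unliftP => [k|] ->.
    rewrite !mxE big_ord1 !mxE eq_sym (negPf (neq_lift _ _)) mul0r subr0.
    rewrite (bigD1 k) //= big1 ?addr0 => [|i' ik]; rewrite !mxE.
      by rewrite eqxx mul1r.
    by rewrite (inj_eq lift_inj) eq_sym (negPf ik) mul0r.
  rewrite !mxE big_ord1 mxE !eqxx mul1r big1 ?add0r // => k _.
  by rewrite !mxE (negPf (neq_lift _ _)) mul0r.
have rowN (c : 'cV_m) : row' j (N *m c) = c.
  by apply/colP => k; rewrite mxE NE liftK.
exists N; split=> [c Nc0|v].
  by rewrite -(rowN c) Nc0; apply/colP => k; rewrite !mxE.
split=> [fv0|[c _ <-]]; last first.
  by rewrite lformE rowN NE unlift_none addNr mulr0.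
exists (row' j v) => //; apply/colP => i; rewrite NE.
case: unliftP => [k|] ->; first by rewrite mxE.
move/eqP: fv0; rewrite lformE (skew_mulf_eq0 D_field) (negPf fj) /=.
by rewrite addr_eq0 => /eqP ->.
Qed.

Lemma rfree_mul m r s (A : 'M[D]_(m, r)) (N : 'M[D]_(r, s)) :
  rfree A -> rfree N -> rfree (A *m N).
Proof. by move=> freeA freeN c; rewrite -mulmxA => /freeA/freeN. Qed.

Lemma rspan_cut m r (A : 'M[D]_(m, r.+1)) (f : 'rV[D]_m) :
  rfree A -> f *m A != 0 ->
  exists A' : 'M[D]_(m, r), rfree A' /\
    forall v, rspan A' v <-> rspan A v /\ lform f v = 0.
Proof.
move=> freeA /ker_lform[N [freeN kerN]].
exists (A *m N); split=> [|v]; first exact: rfree_mul.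
split=> [[c _ <-]|[[c _ <-]]]; rewrite /lform.
  split; first by exists (N *m c) => //; rewrite mulmxA.
  by rewrite -mulmxA mulmxA; apply/kerN; exists c.
by rewrite mulmxA => /kerN[c' _ <-]; exists c'; rewrite ?mulmxA.
Qed.

(** Turns a parametrised flat into a known number of equations. In the induction, the equations of
    the last columns are composed with the projection along the image of the first column, which
    costs one equation. *)
Lemma rspan_equations m r (A : 'M[D]_(m, r)) : rfree A ->
  exists s (F : 'M[D]_(s, m)), [/\ m = (r + s)%N,
    forall y : 'cV_s, exists v, F *m v = y
    & forall v, F *m v = 0 <-> rspan A v].
Proof.
elim: r A => [|r IH] A freeA.
  exists m, 1%:M; split=> // [y|v]; first by exists y; rewrite mul1mx.
  rewrite mul1mx; split=> [->|[c _ <-]]; first by exists 0; rewrite ?mulmx0.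
  by rewrite [c]flatmx0 mulmx0.
pose a : 'cV[D]_m := @lsubmx _ m 1 r A; pose A1 := @rsubmx _ m 1 r A.
have AE (b : 'cV_1) (c : 'cV_r) : A *m col_mx b c = a *m b + A1 *m c.
  by rewrite -mul_row_col hsubmxK.
have spanA v : rspan A v <-> exists x, rspan A1 (v - rscale a x).
  split=> [[c _ <-]|[x [c _ E]]].
    exists (@usubmx _ 1 r 1 c 0 0), (@dsubmx _ 1 r 1 c) => //.
    rewrite -[X in A *m X](@vsubmxK _ 1 r 1) AE rscaleE -mx11_scalar.
    by rewrite addrAC subrr add0r.
  by exists (col_mx x%:M c) => //; rewrite AE -rscaleE E addrC subrK.
have freeA1 : rfree A1.
  move=> c Ac; have := AE 0 c; rewrite Ac mulmx0 addr0 => /freeA.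
  by move=> /(congr1 (@dsubmx _ 1 r 1)); rewrite col_mxKd linear0.
have span_a : ~ rspan A1 a.
  move=> [c _ Ac]; have := AE 1%:M (- c).
  rewrite mulmx1 mulmxN Ac subrr => /freeA /(congr1 (@usubmx _ 1 r 1)).
  rewrite col_mxKu linear0 => /matrixP/(_ 0 0).
  by rewrite !mxE => /eqP; rewrite oner_eq0.
(* Zero equations would mean that [A1] spans everything, including [a]. *)
have [[|s] [F [ms surjF kerF]]] := IH _ freeA1.
  by case: span_a; apply/kerF; rewrite [LHS]flatmx0.
have Fa : F *m a != 0 by apply/eqP => /kerF.
have [S [surjS kerS]] := project_along Fa.
exists s, (S *m F); split=> [|y|v]; first by rewrite ms addnS.
  have [z <-] := surjS y; have [v <-] := surjF z; by exists v; rewrite mulmxA.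
rewrite -mulmxA kerS spanA; split=> -[x E]; exists x.
  by apply/kerF; rewrite mulmxBr E mulmx_rscale subrr.
by move/kerF/eqP: E; rewrite mulmxBr mulmx_rscale subr_eq0 => /eqP.
Qed.

(** * Points, hyperplanes and lines *)

Lemma ray_id d (v : 'cV[D]_d.+1) : ray v v.
Proof. by exists 1; rewrite ?rscale1. Qed.

Lemma ray_rscale d (v : 'cV[D]_d.+1) a : a != 0 -> ray (rscale v a) = ray v.
Proof.
move=> a0; apply/seteqP; split=> _ [b _ <-].
  by exists (a * b); rewrite ?rscaleA.
by exists (a^-1 * b); rewrite // -!rscaleA rscaleK.
Qed.

Lemma ray_inj d (v w : 'cV[D]_d.+1) : w != 0 ->
  ray v = ray w -> exists2 a, a != 0 & w = rscale v a.
Proof.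
move=> w0 vw; have : ray v w by rewrite vw; apply: ray_id.
case=> a _ wE; exists a => //; apply: contra_neq w0 => a0.
by rewrite -wE a0 rscale0.
Qed.

Lemma points_ray d (v : 'cV[D]_d.+1) : v != 0 -> points (ray v).
Proof. by exists v. Qed.

Lemma ray_sub_rspan d r (A : 'M[D]_(d.+1, r)) v :
  ray v `<=` rspan A <-> rspan A v.
Proof.
split=> [|[c _ <-] _ [a _ <-]]; first by apply; apply: ray_id.
by exists (rscale c a); rewrite ?mulmx_rscale.
Qed.

Definition zeros d (f : 'rV[D]_d.+1) : set (pspace D d) :=
  [set p | points p /\ p `<=` [set v | lform f v = 0]].

Lemma zeros_ray d (f : 'rV[D]_d.+1) v :
  v != 0 -> zeros f (ray v) <-> lform f v = 0.
Proof.
move=> v0; split=> [[_]|fv]; first by apply; apply: ray_id.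
split=> [|_ [a _ <-]]; first exact: points_ray.
by rewrite /= lformZ fv mul0r.
Qed.

Lemma zeros_scale d (f : 'rV[D]_d.+1) a : a != 0 -> zeros (a *: f) = zeros f.
Proof.
move=> a0; apply/seteqP; split=> p [pp p_sub]; split=> // v /p_sub /=; rewrite lformZl.
  by move=> /eqP; rewrite (skew_mulf_eq0 D_field) (negPf a0) => /eqP.
by move=> ->; rewrite mulr0.
Qed.

Lemma hyperplaneP d (H : set (pspace D d.+1)) :
  hyperplane H <-> exists2 f, f != 0 & H = zeros f.
Proof.
split=> [[A [freeA ->]]|[f f0 ->]]; last first.
  have [N [freeN kerN]] := ker_lform f0.
  exists N; split=> //; apply/seteqP; split=> p /= [pp p_sub]; split=> // v /p_sub.
    by move=> /kerN.
  by move=> /kerN.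
have [s [f [ms surjf kerf]]] := rspan_equations freeA.
(* [d.+2] coordinates and [d.+1] free columns leave exactly one equation. *)
have s1 : s = 1%N by apply/eqP; rewrite -(eqn_add2l d.+1) -ms addn1.
move: f surjf kerf; rewrite s1 => f surjf kerf; exists f.
  have [v fv] := surjf 1%:M; apply: contra_eqN fv => /eqP ->.
  rewrite mul0mx; apply/eqP => /matrixP/(_ 0 0)/esym/eqP.
  by rewrite !mxE oner_eq0.
apply/seteqP; split=> p /= [pp p_sub]; split=> // v /p_sub.
  by move=> /kerf/lform_eq0.
by move=> /lform_eq0/kerf.
Qed.

(** If [w] has f(w) = 1, then v - w f(v) lies in the kernel of [f], so the factor is g(w). *)
Lemma lform_ker_sub m (f g : 'rV[D]_m) : f != 0 ->
  (forall v, lform f v = 0 -> lform g v = 0) ->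
  exists a, forall v, lform g v = a * lform f v.
Proof.
move=> /lform_eq1_exists[w fw] fg; exists (lform g w) => v.
have := fg (v - rscale w (lform f v)).
rewrite !lformB !lformZ fw mul1r subrr => /(_ erefl)/eqP.
by rewrite subr_eq0 => /eqP.
Qed.

Lemma flat_zerosI d (f g : 'rV[D]_d.+3) : f != 0 -> g != 0 ->
  zeros f <> zeros g -> flat d (zeros f `&` zeros g).
Proof.
move=> f0 g0 fg; have [N [freeN kerN]] := ker_lform f0.
(* Were [g] zero on the kernel of [f], it would be a nonzero multiple of [f] and define the same
   hyperplane. *)
have gN : g *m N != 0.
  apply/eqP => gN; apply: fg.
  have [v fv|a gE] := lform_ker_sub (g := g) f0.
    by have /kerN[c _ <-] := fv; rewrite /lform mulmxA gN mul0mx mxE.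
  have a0 : a != 0.
    apply: contra_neq g0 => a0; apply/rowP => j; rewrite mxE.
    by have := gE (delta_mx j 0); rewrite a0 mul0r /lform -colE mxE.
  apply/seteqP; split=> p [pp p_sub]; split=> // v /p_sub /=; rewrite gE.
    by move=> ->; rewrite mulr0.
  by move=> /eqP; rewrite (skew_mulf_eq0 D_field) (negPf a0) => /eqP.
have [A [freeA spanA]] := rspan_cut freeN gN.
exists A; split=> //; apply/seteqP; split=> p.
  move=> [[pp p_f] [_ p_g]]; split=> // v pv; apply/spanA.
  by split; [apply/kerN/p_f | apply: p_g].
by move=> [pp p_sub]; split; split=> // v /p_sub /spanA[/kerN].
Qed.

(** In the coordinates D^2 of the line, project along the coordinates [c] of [u]. The coordinates
    [c'] of [v] have nonzero image, as the points differ; this determines the coefficient of [v],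
    and the remainder is a multiple of [c]. *)
Lemma line_join d (F : set (pspace D d)) u v : line F ->
  u != 0 -> v != 0 -> F (ray u) -> F (ray v) -> ray u <> ray v ->
  F = [set p | points p /\
    p `<=` [set w | exists a b, w = rscale u a + rscale v b]].
Proof.
move=> [A [freeA ->]] u0 v0.
move=> [_ /ray_sub_rspan[c _ cE]] [_ /ray_sub_rspan[c' _ cE']] uv.
have c0 : c != 0 by apply: contra_neq u0 => c0; rewrite -cE c0 mulmx0.
have [S [_ kerS]] := project_along c0.
have Sc' : (S *m c') 0 0 != 0.
  apply/eqP => S0; have /kerS[a c'a] : S *m c' = 0.
    by apply/matrixP => i j; rewrite !ord1 S0 mxE.
  apply: uv; rewrite -cE' c'a mulmx_rscale cE ray_rscale //.
  by apply: contra_neq v0 => a0; rewrite -cE' c'a a0 rscale0 mulmx0.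
apply/seteqP; split=> p [pp p_sub]; split=> // w /p_sub.
  case=> x _ <-; pose b := ((S *m c') 0 0)^-1 * (S *m x) 0 0.
  have /kerS[a xa] : S *m (x - rscale c' b) = 0.
    apply/matrixP => i j; rewrite !ord1 mulmxBr mulmx_rscale.
    rewrite mxE [X in _ + X]mxE [X in - X]mxE mulVKr; last exact: D_field.
    by rewrite subrr mxE.
  exists a, b; rewrite -cE -cE' -!mulmx_rscale -mulmxDr.
  by rewrite -xa subrK.
move=> [a [b ->]]; rewrite -cE -cE'.
by exists (rscale c a + rscale c' b); rewrite // mulmxDr !mulmx_rscale.
Qed.

End RightLinearAlgebra.

(** * Two facts on cardinality *)

Lemma card_ge3P T (A : set T) : `I_3 #<= A <->
  exists x y z, [/\ A x, A y, A z & [/\ x <> y, x <> z & y <> z]].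
Proof.
split=> [|[x [y [z [Ax Ay Az [xy xz yz]]]]]].
  elim/Ppointed: T => T in A *.
    by rewrite emptyE => /eqP /seteqP[/(_ 0%N)] /(_ isT).
  move=> /pcard_leP[f].
  exists (f 0%N), (f 1%N), (f 2%N).
  split; [exact: funS|exact: funS|exact: funS|].
  by split=> /(@inj _ _ _ f) => /(_ (mem_set _) (mem_set _)) E;
    have := E isT isT.
apply/card_subP; exists (nth x [:: x; y; z] @` `I_3).
  apply: inj_card_eq => i j; rewrite !in_setE.
  by move: i j => [|[|[|i]]] [|[|[|j]]] //= _ _ E; congruence.
by move=> _ [[|[|[|i]]] // _ <-].
Qed.

Lemma finite_inj_surj (T : choiceType) (A : set T) (f : T -> T) :
  finite_set A -> {homo f : x / A x} -> injective f ->
  forall y, A y -> exists2 x, A x & f x = y.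
Proof.
move=> /finite_seqP[s ->] fA f_inj y ys.
have U : uniq (map f (undup s)) by rewrite map_inj_uniq ?undup_uniq.
have [||_ E] := uniq_min_size U (s2 := undup s); rewrite ?size_map //.
  by move=> _ /mapP[x xs ->]; move: xs; rewrite !mem_undup; apply: fA.
have : y \in map f (undup s) by rewrite E mem_undup.
by move=> /mapP[x]; rewrite mem_undup => xs ->; exists x.
Qed.

(** * Embedded designs with a transversal point *)

Section EmbeddedDesign.
Variable D : unitRingType.
Hypothesis D_field : GRing.field_axiom D.
Variables d n : nat.
Variables (V : set (pspace D d.+2)) (P B : set (set (pspace D d.+2))).
Variable ell : set (pspace D d.+2) -> set (pspace D d.+2).
Variables f1 f2 f3 : 'rV[D]_d.+3.
Hypothesis V_td : transversal_design 3 n V P B.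
Hypothesis V_emb : embedded V P B ell (zeros f1) (zeros f2) (zeros f3).

(** Ranges over the three hyperplanes through their forms, so that one argument serves all of
    them. *)
Definition side f := [\/ f = f1, f = f2 | f = f3].

Lemma parts_distinct : [/\ V `&` zeros f1 <> V `&` zeros f2,
  V `&` zeros f1 <> V `&` zeros f3 & V `&` zeros f2 <> V `&` zeros f3].
Proof.
have : `I_3 #<= P by have := td_card_parts V_td => /card_eqPle[].
rewrite (emb_parts V_emb) => /card_ge3P[X [Y [Z [HX HY HZ [XY XZ YZ]]]]].
split=> E; rewrite E in HX HY HZ;
  case: HX => [[]|] HX; case: HY => [[]|] HY; case: HZ => [[]|] HZ; congruence.
Qed.

Lemma part_side f : side f -> P (V `&` zeros f).
Proof. by rewrite (emb_parts V_emb); case=> ->; [left; left|left; right|right]. Qed.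

Lemma side_inj f g p : side f -> side g -> V p -> zeros f p -> zeros g p -> f = g.
Proof.
move=> sf sg Vp fp gp; have [_ tP _] := td_partition V_td.
have := tP _ _ (part_side sf) (part_side sg).
have I : (id (V `&` zeros f) `&` id (V `&` zeros g)) !=set0 by exists p.
move=> /(_ I); have [n12 n13 n23] := parts_distinct.
by case: sf sg => -> [] -> // E; case: notF; exfalso; auto.
Qed.

Lemma in_side p : V p -> exists2 f, side f & zeros f p.
Proof.
have [cP _ _] := td_partition V_td; rewrite -[in X in X -> _]cP.
rewrite (emb_parts V_emb) => -[X [[]|] -> [_ Hp]].
- by exists f1 => //; constructor 1.
- by exists f2 => //; constructor 2.
- by exists f3 => //; constructor 3.
Qed.

Lemma V_ray p : V p -> exists2 v, v != 0 & p = ray v.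
Proof. by move=> /(emb_points V_emb). Qed.

Lemma block_sub b p : B b -> b p -> V p.
Proof. by move=> /(td_block V_td)[bV _] /bV. Qed.

(** Distinct points of a block share that block, hence cannot share a part. *)
Lemma block_side_inj b f p q :
  B b -> side f -> b p -> b q -> zeros f p -> zeros f q -> p = q.
Proof.
move=> Bb sf bp bq fp fq; apply: contrapT => pq.
have Vp := block_sub Bb bp; have Vq := block_sub Bb bq.
have [[_ nB]|[_ nP]] := td_pair V_td Vp Vq pq; first by apply: nB; exists b.
by apply: nP; exists (V `&` zeros f); [apply: part_side|].
Qed.

(** The three points of a block lie on pairwise different sides, so every side is hit. *)
Lemma block_meets b f : B b -> side f -> exists2 p, b p & zeros f p.
Proof.
move=> Bb sf; have [bV /card_eqPle[_ /card_ge3P]] := td_block V_td Bb.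
move=> [x [y [z [bx by_ bz [xy xz yz]]]]].
have [fx sx x0] := in_side (bV _ bx).
have [fy sy y0] := in_side (bV _ by_).
have [fz sz z0] := in_side (bV _ bz).
have nxy : fx <> fy by move=> E; apply: xy; apply: (block_side_inj Bb sx); rewrite // E.
have nxz : fx <> fz by move=> E; apply: xz; apply: (block_side_inj Bb sx); rewrite // E.
have nyz : fy <> fz by move=> E; apply: yz; apply: (block_side_inj Bb sy); rewrite // E.
have [E|[E|E]] : f = fx \/ f = fy \/ f = fz.
- by case: sf sx sy sz => -> [] Ex [] Ey [] Ez; try (by left); try (by right; left);
    try (by right; right); exfalso; congruence.
- by exists x; rewrite // E.
- by exists y; rewrite // E.
- by exists z; rewrite // E.
Qed.

Lemma block_line b : B b -> line (ell b) /\ b `<=` ell b.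
Proof. exact: (emb_line V_emb). Qed.

(** The line of [b] already meets the hyperplane in a point of [b]; a second common point would put
    the whole line inside the hyperplane, which an embedding forbids. *)
Lemma block_ray b f x : B b -> side f -> x != 0 -> lform f x = 0 ->
  ell b (ray x) -> b (ray x).
Proof.
move=> Bb sf x0 fx bx; have [p bp fp] := block_meets Bb sf.
have [lb b_sub] := block_line Bb.
have [v v0 pv] := V_ray (block_sub Bb bp); rewrite {}pv in bp fp.
have [<- //|vx] := pselect (ray v = ray x).
have [] : ell b `<=` zeros f -> False.
  by have [n1 n2 n3] := emb_line_notin V_emb Bb; case: sf => ->.
rewrite (line_join D_field lb v0 x0 (b_sub _ bp) bx vx) => r [pr r_sub].
split=> // w /r_sub[a [a' ->]] /=.
by rewrite lformD !lformZ fx (zeros_ray _ v0).1 // !mul0r addr0.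
Qed.

Lemma block_through f g p q : side f -> side g -> f <> g ->
  V p -> V q -> zeros f p -> zeros g q -> exists2 b, B b & b p /\ b q.
Proof.
move=> sf sg fg Vp Vq fp gq.
have pq : p <> q by move=> E; apply: fg; apply: (side_inj sf sg Vp); rewrite // E.
have [[[X [[PX [Xp Xq]] _]] _]|[[b [[Bb bpq] _]] _]] := td_pair V_td Vp Vq pq;
  last by exists b.
exfalso; have [h sh hX] : exists2 h, side h & X = V `&` zeros h.
  move: PX; rewrite (emb_parts V_emb) => -[[]|] ->.
  - by exists f1 => //; constructor 1.
  - by exists f2 => //; constructor 2.
  - by exists f3 => //; constructor 3.
move: Xp Xq; rewrite hX => -[_ hp] [_ hq]; apply: fg.
by rewrite (side_inj sf sh Vp fp hp) (side_inj sg sh Vq gq hq).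
Qed.

Lemma block_combo b u v x a c : B b -> ell b (ray u) -> ell b (ray v) ->
  x = rscale u a + rscale v c -> x != 0 -> ell b (ray x).
Proof.
move=> Bb; have [[A [freeA ->]] _] := block_line Bb.
move=> [_ /ray_sub_rspan[s _ <-]] [_ /ray_sub_rspan[t _ <-]] xE x0.
split; [exact: points_ray | apply/ray_sub_rspan].
by exists (rscale s a + rscale t c); rewrite // mulmxDr !mulmx_rscale.
Qed.

Lemma sides_neq : [/\ f1 <> f2, f1 <> f3 & f2 <> f3].
Proof. by have [n1 n2 n3] := emb_distinct V_emb; split=> E; rewrite E in n1 n2 n3. Qed.

Lemma side_off f g v : side f -> side g -> f <> g -> v != 0 -> V (ray v) ->
  lform f v = 0 -> lform g v != 0.
Proof.
move=> sf sg fg v0 Vv fv; apply/eqP => gv; apply: fg.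
by apply: (side_inj sf sg Vv); apply/zeros_ray.
Qed.

(** * Consequences of a transversal point *)

Section TransversalPoint.
Variable w : 'cV[D]_d.+3.
Hypothesis w0 : w != 0.
Hypothesis w_transversal : transversal_point n V B ell (ray w).

Lemma transversal_block p : V p -> exists b, [/\ B b, b p & ell b (ray w)].
Proof.
have [_ [C [CB _ [cC _ _] Cw]]] := w_transversal.
by rewrite -[in X in X -> _]cC => -[b Cb bp]; exists b; split; auto.
Qed.

(** Otherwise the transversal point would belong to every block of [C], whereas [C] contains several
    blocks and they are disjoint. *)
Lemma transversal_off f : side f -> lform f w != 0.
Proof.
move=> sf; apply/eqP => fw; have [_ [C [CB Cn [_ tC _] Cw]]] := w_transversal.
have /card_ge3P[b [c [_ [Cb Cc _ [bc _ _]]]]] : `I_3 #<= C.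
  by rewrite (card_le_eqr Cn) card_le_II (td_n V_td).
apply: bc; apply: tC => //; exists (ray w).
by split; apply: (block_ray _ sf) => //; auto.
Qed.

(** Projection from [w] onto a side keeps points in [V]: the block of the partition through [v] has
    its line through [w], and that line meets the side only in a point of the block. *)
Lemma transversal_combo f v x a c : side f -> V (ray v) ->
  x = rscale v a + rscale w c -> x != 0 -> lform f x = 0 -> V (ray x).
Proof.
move=> sf Vv xE x0 fx; have [b [Bb bv bw]] := transversal_block Vv.
have [_ b_sub] := block_line Bb.
apply: (block_sub Bb); apply: (block_ray Bb sf) => //.
exact: (block_combo Bb (b_sub _ bv) bw xE).
Qed.

Hypotheses (f1w : lform f1 w = 1) (f2w : lform f2 w = 1) (f3w : lform f3 w = 1).

Let s1 : side f1. Proof. by constructor 1. Qed.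
Let s2 : side f2. Proof. by constructor 2. Qed.
Let s3 : side f3. Proof. by constructor 3. Qed.

(** The set T of values of f_2 / f_3; the normalisation f_3(v) = 1 makes the quotient a plain value
    of f_2. *)
Definition ratio_set : set D := [set t | exists v,
  [/\ V (ray v), lform f1 v = 0, lform f3 v = 1 & lform f2 v = t]].

Lemma ratio_set_neq0 t : ratio_set t -> t != 0.
Proof.
move=> [v [Vv f1v f3v <-]]; have [n12 _ _] := sides_neq.
apply: (side_off s1 s2) => //; apply: (@lform_neq0_vec _ _ f3).
by rewrite f3v oner_neq0.
Qed.

(** Projecting [v] from [w] onto H_3 gives v - w, a point of [V] on H_3 and so off H_2; there f_2
    takes the value t - 1. *)
Lemma ratio_set_neq1 t : ratio_set t -> t != 1.
Proof.
move=> [v [Vv f1v f3v f2v]]; have [_ _ n23] := sides_neq.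
pose x := rscale v 1 + rscale w (- 1).
have x0 : x != 0.
  apply: (@lform_neq0_vec _ _ f1).
  by rewrite lformD !lformZ f1v f1w mul0r add0r mul1r oppr_eq0 oner_neq0.
have f3x : lform f3 x = 0 by rewrite lformD !lformZ f3v f3w !mul1r subrr.
have Vx : V (ray x) by apply: (transversal_combo s3 Vv erefl).
have := side_off s3 s2 (nesym n23) x0 Vx f3x.
by rewrite lformD !lformZ f2v f2w mulr1 mul1r subr_eq0.
Qed.

Lemma ratio_set_closed s t :
  ratio_set s -> ratio_set t -> ratio_set (s * (1 - t^-1) + 1).
Proof.
move=> rs rt; have t0 := ratio_set_neq0 rt; have ut := D_field t0.
have t1 := ratio_set_neq1 rt; have [n12 n13 n23] := sides_neq.
case: rs => v [Vv f1v f3v f2v]; case: rt => v' [Vv' f1v' f3v' f2v'].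
(* Project v' from w onto H_2 (x2), join the image to v and meet H_3 (x3), and
   project back from w onto H_1 (x1). *)
have v0 : v != 0 by apply: (@lform_neq0_vec _ _ f3); rewrite f3v oner_neq0.
pose x2 := rscale v' 1 + rscale w (- t).
have f1x2 : lform f1 x2 = - t by rewrite lformD !lformZ f1v' f1w mul0r add0r mul1r.
have f2x2 : lform f2 x2 = 0 by rewrite lformD !lformZ f2v' f2w mulr1 mul1r subrr.
have f3x2 : lform f3 x2 = 1 - t by rewrite lformD !lformZ f3v' f3w !mul1r.
have x20 : x2 != 0 by apply: (@lform_neq0_vec _ _ f1); rewrite f1x2 oppr_eq0.
have Vx2 : V (ray x2) by apply: (transversal_combo s2 Vv' erefl).
have [b Bb [bv bx2]] := block_through s1 s2 n12 Vv Vx2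
  ((zeros_ray _ v0).2 f1v) ((zeros_ray _ x20).2 f2x2).
have [_ b_sub] := block_line Bb.
(* The coefficients cancel f_3, whose values at [v] and [x2] are 1 and 1 - t. *)
pose x3 := rscale v (t - 1) + rscale x2 1.
have f1x3 : lform f1 x3 = - t by rewrite lformD !lformZ f1v f1x2 mul0r add0r mulr1.
have f2x3 : lform f2 x3 = s * (t - 1) by rewrite lformD !lformZ f2v f2x2 mul0r addr0.
have f3x3 : lform f3 x3 = 0.
  by rewrite lformD !lformZ f3v f3x2 mul1r mulr1 -opprB addNr.
have x30 : x3 != 0 by apply: (@lform_neq0_vec _ _ f1); rewrite f1x3 oppr_eq0.
have Vx3 : V (ray x3).
  apply: (block_sub Bb); apply: (block_ray Bb s3) => //.
  exact: (block_combo Bb (b_sub _ bv) (b_sub _ bx2) erefl).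
(* Since f_1(x3) = -t and f_1(w) = 1, these coefficients cancel f_1. *)
pose x1 := rscale x3 t^-1 + rscale w 1.
have f1x1 : lform f1 x1 = 0.
  by rewrite lformD !lformZ f1x3 f1w mulNr divrr // mulr1 addNr.
have f3x1 : lform f3 x1 = 1 by rewrite lformD !lformZ f3x3 f3w mul0r add0r mulr1.
have x10 : x1 != 0 by apply: (@lform_neq0_vec _ _ f3); rewrite f3x1 oner_neq0.
exists x1; split=> //; first exact: (transversal_combo s1 Vx3 erefl).
by rewrite lformD !lformZ f2x3 f2w mulr1 -mulrA mulrBl divrr // mul1r.
Qed.

Lemma card_side f : side f -> V `&` zeros f #= `I_n.
Proof. by move=> sf; apply: (td_card_part V_td); apply: part_side. Qed.

Lemma finite_ratio_set : finite_set ratio_set.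
Proof.
(* [xget] chooses a nonzero representative of the point; the quotient does not depend on the choice,
   because a right scalar cancels in it. *)
pose ratio (p : pspace D d.+2) :=
  let v := xget 0 [set v | p v /\ v != 0] in lform f2 v / lform f3 v.
apply: (@sub_finite_set _ _ (ratio @` (V `&` zeros f1))); last first.
  by apply: finite_image; exists n; apply: card_side.
move=> t rt; case: (rt) => v [Vv f1v f3v f2v].
have v0 : v != 0 by apply: (@lform_neq0_vec _ _ f3); rewrite f3v oner_neq0.
exists (ray v); first by split=> //; apply/zeros_ray.
rewrite /ratio; case: xgetP => [_ -> [[a _ <-] a0]|/(_ v)[]]; last first.
  by split=> //; apply: ray_id.
have {}a0 : a != 0 by apply: contra_neq a0 => ->; rewrite rscale0.
by rewrite !lformZ f2v f3v mul1r mulrK //; apply: D_field.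
Qed.

Lemma ratio_set_constant s t : ratio_set s -> ratio_set t -> s = t.
Proof.
have [r rE] := (finite_seqP _).1 finite_ratio_set.
have memr x : (x \in undup r) <-> ratio_set x by rewrite mem_undup rE.
have := @ratios_size_le1 D D_field (undup r) (undup_uniq _).
have r0 : 0 \notin undup r by apply/negP => /memr/ratio_set_neq0; rewrite eqxx.
have r1 : 1 \notin undup r by apply/negP => /memr/ratio_set_neq1; rewrite eqxx.
move=> /(_ r0 r1) size_le1 /memr sr /memr tr.
have {size_le1} := size_le1 (fun y z yr zr =>
  (memr _).2 (ratio_set_closed ((memr _).1 yr) ((memr _).1 zr))).
by case: (undup r) sr tr => [|x [|]] //; rewrite !inE => /eqP -> /eqP ->.
Qed.

(** The form vanishes at [w], where f_1, f_2, f_3 are all 1, and on the points of [V] on H_1, where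
    they are 0, t, 1 after scaling. Every point of [V] lies on a line joining [w] to such a
    point. *)
Lemma V_in_pencil : exists2 t, t != 0 &
  V `<=` zeros ((t - 1) *: f1 + f2 - t *: f3).
Proof.
have norm p : V p -> zeros f1 p ->
    exists2 v, p = ray v & [/\ V (ray v), lform f1 v = 0 & lform f3 v = 1].
  move=> Vp f1p; have [v v0 pv] := V_ray Vp; rewrite {}pv in Vp f1p *.
  have f1v := (zeros_ray _ v0).1 f1p; have [_ n13 _] := sides_neq.
  have f3v := side_off s1 s3 n13 v0 Vp f1v.
  have i0 : (lform f3 v)^-1 != 0 by rewrite invr_eq0.
  exists (rscale v (lform f3 v)^-1); rewrite ray_rscale //.
  by split; rewrite // lformZ ?f1v ?mul0r // divrr //; apply: D_field.
have [p1 [Vp1 f1p1]] : V `&` zeros f1 !=set0.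
  have [_ _] := td_partition V_td; apply; exact: part_side.
have [v1 _ [Vv1 f1v1 f3v1]] := norm _ Vp1 f1p1.
pose t := lform f2 v1; have rt : ratio_set t by exists v1.
exists t => [|p Vp]; first exact: ratio_set_neq0.
have [b [Bb bp bw]] := transversal_block Vp; have [lb b_sub] := block_line Bb.
have [q bq f1q] := block_meets Bb s1.
have [v qv [Vv f1v f3v]] := norm _ (block_sub Bb bq) f1q.
have f2v : lform f2 v = t by apply: ratio_set_constant rt; exists v.
have v0 : v != 0 by apply: (@lform_neq0_vec _ _ f3); rewrite f3v oner_neq0.
have vw : ray v <> ray w.
  move=> E; have : zeros f1 (ray w) by rewrite -E -qv.
  by rewrite zeros_ray // f1w => /eqP; rewrite oner_eq0.
split=> [|u pu]; first exact: (emb_points V_emb).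
have := b_sub _ bp; rewrite (line_join D_field lb v0 w0 _ bw vw); last first.
  by rewrite -qv; apply: b_sub.
move=> [_ /(_ _ pu)[a [c ->]]] /=; rewrite lformD !lformZ !lformDl !lformNl.
rewrite !lformZl f1v f2v f3v f1w f2w f3w !mulr1 mulr0 add0r subrr mul0r add0r.
by rewrite subrK subrr mul0r.
Qed.

(** Properness makes the form of [V_in_pencil] zero. As t is nonzero, f_3 then vanishes wherever f_1
    and f_2 do, so the triple intersection is that of two distinct hyperplanes. *)
Lemma flat_sides : proper_embedding V ->
  flat d (zeros f1 `&` zeros f2 `&` zeros f3).
Proof.
move=> properV; have [t t0 V_sub] := V_in_pencil.
have [g0|g0] := eqVneq ((t - 1) *: f1 + f2 - t *: f3) 0; last first.
  by case: properV; exists (zeros ((t - 1) *: f1 + f2 - t *: f3)); split=> //;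
    apply/(hyperplaneP D_field); exists ((t - 1) *: f1 + f2 - t *: f3).
have -> : zeros f1 `&` zeros f2 `&` zeros f3 = zeros f1 `&` zeros f2.
  rewrite setIidl // => p [[pp p1] [_ p2]]; split=> // v pv.
  have : lform ((t - 1) *: f1 + f2 - t *: f3) v = 0 by rewrite g0 lform0l.
  rewrite !lformDl lformNl !lformZl (p1 _ pv) (p2 _ pv) mulr0 !add0r => /eqP.
  by rewrite oppr_eq0 (skew_mulf_eq0 D_field) (negPf t0) => /eqP.
have [n12 _ _] := emb_distinct V_emb.
apply: flat_zerosI => //.
  by apply: contra_eq_neq f1w => ->; rewrite lform0l eq_sym oner_neq0.
by apply: contra_eq_neq f2w => ->; rewrite lform0l eq_sym oner_neq0.
Qed.

End TransversalPoint.
End EmbeddedDesign.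

(** * Adapted coordinates *)

Section Coordinates.
Variable D : unitRingType.
Hypothesis D_field : GRing.field_axiom D.
Variable d : nat.

Notation cvec := (@cvec3 D d.+2).

Lemma cvec3D x y z x' y' z' :
  cvec x y z + cvec x' y' z' = cvec (x + x') (y + y') (z + z').
Proof.
by apply/colP => i; rewrite !mxE; case: insubP => [j _ _|_]; rewrite ?mxE //; case: ifP.
Qed.

Lemma cvec3Z x y z a : rscale (cvec x y z) a = cvec (rscale x a) (y * a) (z * a).
Proof.
by apply/colP => i; rewrite !mxE; case: insubP => [j _ _|_]; rewrite ?mxE //; case: ifP.
Qed.

Lemma cvec30 : cvec 0 0 0 = 0.
Proof.
by apply/colP => i; rewrite !mxE; case: insubP => [j _ _|_]; rewrite ?mxE //; case: ifP.
Qed.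

Lemma cvec3_inj x y z x' y' z' :
  cvec x y z = cvec x' y' z' -> [/\ x = x', y = y' & z = z'].
Proof.
move=> /colP E; split.
- apply/colP => j; have ltj : (j < d.+3)%N.
    exact: leq_trans (ltn_ord j) (leqW (leqnSn d.+1)).
  by have := E (Ordinal ltj); rewrite !mxE /= (valK j).
- have lt1 : (d.+1 < d.+3)%N by [].
  by have := E (Ordinal lt1); rewrite !mxE /= insubF ?ltnn // eqxx.
- have := E ord_max; rewrite !mxE /= insubF; last by rewrite ltnNge leqnSn.
  by rewrite gtn_eqF.
Qed.

Lemma cvec3_surj c : exists x y z, c = cvec x y z.
Proof.
have le1 : (d.+1 <= d.+3)%N by exact: leqW (leqnSn _).
have lt1 : (d.+1 < d.+3)%N by [].
exists (\col_j c (widen_ord le1 j) 0), (c (Ordinal lt1) 0), (c ord_max 0).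
apply/colP => i; rewrite mxE; case: insubP => [j _ ji|].
  by rewrite mxE; congr (c _ 0); apply: val_inj.
rewrite -leqNgt /= => id1; case: ifP => [/eqP E|E].
  by congr (c _ 0); apply: val_inj.
congr (c _ 0); apply: val_inj => /=; apply/eqP.
by rewrite eqn_leq -[(i <= _)%N]ltnS ltn_ord /= ltn_neqAle eq_sym E id1.
Qed.

Variable M : 'M[D]_d.+3.
Hypothesis M_basis : rbasis M.

Lemma rbasis_inj (c c' : 'cV[D]_d.+3) : M *m c = M *m c' -> c = c'.
Proof.
move=> /eqP; rewrite -subr_eq0 -mulmxBr => /eqP/M_basis.1/eqP.
by rewrite subr_eq0 => /eqP.
Qed.

Lemma hcoord_neq0 x y z : cvec x y z != 0 -> M *m cvec x y z != 0.
Proof. by apply: contra_neq => /M_basis.1. Qed.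

Lemma cvec3_neq0 x y z : (y != 0) || (z != 0) -> cvec x y z != 0.
Proof.
by apply: contraTneq; rewrite -cvec30 => /cvec3_inj[_ -> ->]; rewrite eqxx.
Qed.

Lemma hcoordP p : points p ->
  exists x y z, p = hcoord M x y z /\ M *m cvec x y z != 0.
Proof.
move=> [v v0 ->]; have [c _ vE] : rspan M v by rewrite M_basis.2.
by have [x [y [z cE]]] := cvec3_surj c; exists x, y, z; rewrite /hcoord -cE vE.
Qed.

Lemma hcoordZ x y z a : a != 0 ->
  hcoord M (rscale x a) (y * a) (z * a) = hcoord M x y z.
Proof. by move=> a0; rewrite /hcoord -cvec3Z mulmx_rscale ray_rscale. Qed.

Lemma hyperplane_ratio_hyperplane a : hyperplane (hyperplane_ratio M a).
Proof.
(* The columns of [N] are preimages of the unit vectors under [M], which gives a right inverse;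
   freeness of [M] makes it a left inverse too. The equation y - a z = 0 is then transported by
   [N]. *)
have [N NK] : exists N : 'M[D]_d.+3, forall v : 'cV_d.+3, M *m (N *m v) = v.
  have col_ex i : exists c, M *m c = col i 1%:M :> 'cV[D]_d.+3.
    have [c _ cE] : rspan M (col i 1%:M) by rewrite M_basis.2.
    by exists c.
  have [c cE] := choice col_ex; exists (\matrix_(i, j) c j i 0) => v.
  rewrite mulmxA -[RHS]mul1mx; congr (_ *m v); apply/matrixP => i j.
  have := congr1 (fun u : 'cV_d.+3 => u i 0) (cE j); rewrite [in RHS]mxE => E.
  rewrite [RHS]mxE; move: E; rewrite !mxE => <-.
  by apply: eq_bigr => k _; rewrite mxE.
have MK (c : 'cV_d.+3) : N *m (M *m c) = c by apply: rbasis_inj; rewrite NK.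
have lt1 : (d.+1 < d.+3)%N by [].
pose f : 'rV[D]_d.+3 := delta_mx 0 (Ordinal lt1) - a *: delta_mx 0 ord_max.
have fE x y z : lform f (cvec x y z) = y - a * z.
  rewrite lformDl lformNl lformZl /lform -!rowE !mxE /= insubF ?ltnn // eqxx.
  by rewrite insubF ?ltnNge ?leqnSn //= gtn_eqF.
have f0 : f != 0.
  have := fE 0 1 0; rewrite mulr0 subr0; apply: contra_eq_neq => ->.
  by rewrite lform0l eq_sym oner_neq0.
apply/(hyperplaneP D_field); exists (f *m N).
  apply: contra_neq f0 => fN; apply/rowP => j; rewrite [RHS]mxE.
  have -> : f 0 j = lform (f *m N) (M *m delta_mx j 0).
    by rewrite /lform -mulmxA MK -colE [RHS]mxE.
  by rewrite fN lform0l.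
apply/seteqP; split=> p.
  move=> [pp [x [y [z [pE yaz]]]]]; split=> // v; rewrite pE => -[b _ <-] /=.
  by rewrite lformZ /lform -mulmxA MK -/(lform _ _) fE yaz subrr mul0r.
move=> [pp p_sub]; split=> //; have [x [y [z [pE _]]]] := hcoordP pp.
exists x, y, z; split=> //; have := p_sub (M *m cvec x y z).
rewrite pE => /(_ (ray_id _)) /=; rewrite /lform -mulmxA MK -/(lform _ _) fE.
by move=> /eqP; rewrite subr_eq0 => /eqP.
Qed.

End Coordinates.

(** * The multipliers of a finite subgroup *)

Section StabilizerField.
Variable D : unitRingType.
Hypothesis D_field : GRing.field_axiom D.
Variables m : nat.
Variable G : set 'cV[D]_m.
Hypothesis G_zmod : zmod_closed (mem G).
Hypothesis G_finite : finite_set G.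

Lemma zmod0 : G 0.
Proof. by have [] := G_zmod; rewrite in_setE. Qed.

Lemma zmodB x y : G x -> G y -> G (x - y).
Proof.
move=> Gx Gy; have [_ GB] := G_zmod; rewrite -in_setE.
by apply: (GB x y); rewrite in_setE.
Qed.

Lemma zmodN x : G x -> G (- x).
Proof. by move=> Gx; rewrite -sub0r; apply: zmodB => //; apply: zmod0. Qed.

Lemma zmodD x y : G x -> G y -> G (x + y).
Proof. by move=> Gx Gy; rewrite -[y]opprK; apply/zmodB/zmodN. Qed.

Lemma stabilizer0 : stabilizer_field G 0.
Proof. by move=> g _; rewrite rscale0; apply: zmod0. Qed.

Lemma stabilizer1 : stabilizer_field G 1.
Proof. by move=> g; rewrite rscale1. Qed.

Lemma stabilizerB a b :
  stabilizer_field G a -> stabilizer_field G b -> stabilizer_field G (a - b).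
Proof.
move=> Ga Gb g Gg; rewrite rscaleDr rscaleNr.
by apply: zmodB; [apply: Ga | apply: Gb].
Qed.

(** Multiplication by a nonzero [a] is injective on the finite set [G], hence onto, so its inverse
    preserves [G] as well. *)
Lemma stabilizerV a : stabilizer_field G a -> stabilizer_field G a^-1.
Proof.
move=> Ga; have [->|a0 g Gg] := eqVneq a 0; first by rewrite invr0; apply: stabilizer0.
have [h Gh <-] := finite_inj_surj G_finite Ga (rscale_inj D_field a0) Gg.
by rewrite rscaleK.
Qed.

End StabilizerField.

(** * Transversal points in adapted coordinates *)

Section TransversalCoordinates.
Variable D : unitRingType.
Hypothesis D_field : GRing.field_axiom D.
Variables d n : nat.
Variables (V : set (pspace D d.+2)) (P B : set (set (pspace D d.+2))).
Variable ell : set (pspace D d.+2) -> set (pspace D d.+2).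
Variables f1 f2 f3 : 'rV[D]_d.+3.
Hypothesis V_td : transversal_design 3 n V P B.
Hypothesis V_emb : embedded V P B ell (zeros f1) (zeros f2) (zeros f3).
Variables (M : 'M[D]_d.+3) (G : set 'cV[D]_d.+1).
Hypothesis M_adapted : adapted V B (zeros f1) (zeros f2) (zeros f3) M.
Hypothesis G_assoc : associated_group n V (zeros f1) (zeros f2) (zeros f3) M G.

Notation vec x y z := (M *m cvec3 (d := d.+2) x y z).

Let M_basis : rbasis M. Proof. by have [] := M_adapted. Qed.
Let G_zmod := ag_subgroup G_assoc.
Let G_finite : finite_set G. Proof. by exists n; exact: ag_order G_assoc. Qed.
Let s1 : side f1 f2 f3 f1. Proof. by constructor 1. Qed.
Let s2 : side f1 f2 f3 f2. Proof. by constructor 2. Qed.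
Let s3 : side f1 f2 f3 f3. Proof. by constructor 3. Qed.

Lemma vecD x y z x' y' z' : vec x y z + vec x' y' z' = vec (x + x') (y + y') (z + z').
Proof. by rewrite -mulmxDr cvec3D. Qed.

Lemma vecZ x y z a : rscale (vec x y z) a = vec (rscale x a) (y * a) (z * a).
Proof. by rewrite -mulmx_rscale cvec3Z. Qed.

Lemma vec_neq0 x y z : (y != 0) || (z != 0) -> vec x y z != 0.
Proof. by move=> yz; apply/(hcoord_neq0 M_basis)/cvec3_neq0. Qed.

Lemma lform_axis f x : side f1 f2 f3 f -> lform f (vec x 0 0) = 0.
Proof.
move=> sf; have [v0|v0] := eqVneq (vec x 0 0) 0.
  by rewrite v0 /lform mulmx0 mxE.
have [_ axisE _] := M_adapted.
have [[z1 z2] z3] : (zeros f1 `&` zeros f2 `&` zeros f3) (ray (vec x 0 0)).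
  by rewrite axisE; split; [exact: points_ray | exists x].
by apply/(zeros_ray _ v0); case: sf => ->.
Qed.

Let unit_points : [/\ V (ray (vec 0 0 1)) /\ lform f1 (vec 0 0 1) = 0,
  V (ray (vec 0 1 1)) /\ lform f2 (vec 0 1 1) = 0
  & V (ray (vec 0 1 0)) /\ lform f3 (vec 0 1 0) = 0].
Proof.
have [_ _ [p1 [p2 [p3 [_ [[H1 H2 H3] _ [E1 E2 E3]]]]]]] := M_adapted.
have n01 : (0 != 0 :> D) || (1 != 0 :> D) by rewrite oner_neq0 orbT.
have n1 z : (1 != 0 :> D) || (z != 0 :> D) by rewrite oner_neq0.
rewrite {}E1 {}E2 {}E3 /hcoord in H1 H2 H3.
move: H1 H2 H3 => [/zeros_ray H1 V1] [/zeros_ray H2 V2] [/zeros_ray H3 V3].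
by split; split=> //; [apply: H1|apply: H2|apply: H3]; apply: vec_neq0.
Qed.

(** With the next two lemmas, this recovers one direction of the equations of the sides: the vector
    is an axis vector plus a multiple of the unit point on that side. *)
Lemma lform_side1 x z : lform f1 (vec x 0 z) = 0.
Proof.
have -> : vec x 0 z = vec x 0 0 + rscale (vec 0 0 1) z.
  by rewrite vecZ vecD rscale0l !mul0r mul1r !addr0 add0r.
by have [[_ E] _ _] := unit_points; rewrite lformD lformZ lform_axis // E mul0r addr0.
Qed.

Lemma lform_side2 x y : lform f2 (vec x y y) = 0.
Proof.
have -> : vec x y y = vec x 0 0 + rscale (vec 0 1 1) y.
  by rewrite vecZ vecD rscale0l !mul1r !addr0 add0r.
by have [_ [_ E] _] := unit_points; rewrite lformD lformZ lform_axis // E mul0r addr0.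
Qed.

Lemma lform_side3 x y : lform f3 (vec x y 0) = 0.
Proof.
have -> : vec x y 0 = vec x 0 0 + rscale (vec 0 1 0) y.
  by rewrite vecZ vecD rscale0l mul0r mul1r !addr0 add0r.
by have [_ _ [_ E]] := unit_points; rewrite lformD lformZ lform_axis // E mul0r addr0.
Qed.

Lemma transversal_coordinates q : transversal_point n V B ell q ->
  exists g a, [/\ G g, stabilizer_field G a, a <> 0, a <> 1 & q = hcoord M g a 1].
Proof.
move=> tq; have [pq _] := tq.
have [x' [y [z [qE w0]]]] := hcoordP M_basis pq.
have z0 : z != 0.
  rewrite {}qE in tq.
  apply: contra_neq (transversal_off D_field V_td V_emb w0 tq s3) => ->.
  by rewrite lform_side3.
pose x := rscale x' z^-1; pose a := y * z^-1.
have {}qE : q = hcoord M x a 1.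
  rewrite qE -[LHS](@hcoordZ _ D_field _ _ _ _ _ z^-1) ?invr_eq0 //.
  by rewrite divrr //; apply: D_field.
have {}w0 : vec x a 1 != 0 by apply: vec_neq0; rewrite oner_neq0 orbT.
rewrite {}qE in tq *.
have off f (sf : side f1 f2 f3 f) := transversal_off D_field V_td V_emb w0 tq sf.
have a0 : a != 0 by apply: contra_neq (off _ s1) => ->; rewrite lform_side1.
have a1 : a != 1 by apply: contra_neq (off _ s2) => ->; rewrite lform_side2.
have ua := D_field a0.
(* The line joining [g, 0, 1] to the transversal point meets H_3 in [x - g, a, 0], a point of [V];
   writing it as [-h, 1, 0] with [h] in [G] gives -h = (x - g) a^-1. *)
have shift g : G g -> G (rscale (x - g) a^-1).
  move=> Gg; have : (zeros f1 `&` V) (hcoord M g 0 1).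
    by rewrite (ag_H1 G_assoc); exists g.
  move=> [_ Vg].
  pose v3 := rscale (vec g 0 1) (- 1) + rscale (vec x a 1) 1.
  have v3E : v3 = vec (x - g) a 0.
    rewrite /v3 !vecZ vecD rscaleNr !rscale1 mul0r add0r !mulr1 mul1r addNr.
    by rewrite addrC.
  have v30 : v3 != 0 by rewrite v3E; apply: vec_neq0; rewrite a0.
  have f3v3 : lform f3 v3 = 0 by rewrite v3E lform_side3.
  have Vv3 := transversal_combo D_field V_td V_emb tq s3 Vg erefl v30 f3v3.
  have : (zeros f3 `&` V) (ray v3) by split=> //; apply/zeros_ray.
  rewrite (ag_H3 G_assoc) => -[h Gh] /esym; rewrite /hcoord.
  have h0 : vec (- h) 1 0 != 0 by apply: vec_neq0; rewrite oner_neq0.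
  move=> /(ray_inj h0)[b _]; rewrite v3E vecZ.
  move=> /(rbasis_inj M_basis)/cvec3_inj[hE ab _].
  have -> : a^-1 = b by apply: (mulrI ua); rewrite divrr.
  by rewrite -hE; apply: zmodN.
(* The map of [shift] is an injection of the finite [G] into itself, so it takes the value 0, which
   forces [x] into [G]. *)
have [g Gg] : exists2 g, G g & rscale (x - g) a^-1 = 0.
  apply: (finite_inj_surj G_finite shift) => [|]; last exact: zmod0.
  have i0 : a^-1 != 0 by rewrite invr_eq0.
  by move=> g h /(rscale_inj D_field i0) /addrI/oppr_inj.
move=> /eqP; rewrite rscale_eq0 // invr_eq0 (negPf a0) orbF subr_eq0 => /eqP xg.
exists x, a; split; rewrite ?xg //; [|exact/eqP|exact/eqP].
(* As x = g, applying [shift] to g - h shows that h a^-1 is in [G]; so a^-1 preserves [G], and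
   therefore [a] does. *)
rewrite -[a]invrK; apply: stabilizerV => // h Gh.
have := shift (g - h); rewrite xg opprB addrCA subrr addr0; apply.
exact: zmodB.
Qed.

(** * Every admissible point is transversal *)

Section Converse.
Variables (g : 'cV[D]_d.+1) (a : D).
Hypotheses (Gg : G g) (Ga : stabilizer_field G a) (a0 : a != 0) (a1 : a != 1).

Let w := vec g a 1.
Let ua := D_field a0.
Let GV : stabilizer_field G a^-1. Proof. exact: stabilizerV. Qed.
Let w0 : w != 0. Proof. by apply: vec_neq0; rewrite a0. Qed.

(** On each side, [w] is split into a vector of that side and a nonzero multiple of a unit point of
    another side, where the form does not vanish. *)
Lemma converse_off f : side f1 f2 f3 f -> lform f w != 0.
Proof.
have [[V1 z1] [V2 z2] [V3 z3]] := unit_points; have [n12 n13 n23] := sides_neq V_emb.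
have v10 : vec 0 0 1 != 0 by apply: vec_neq0; rewrite oner_neq0 orbT.
have v30 : vec 0 1 0 != 0 by apply: vec_neq0; rewrite oner_neq0.
case=> ->.
- have -> : w = vec g 0 1 + rscale (vec 0 1 0) a.
    by rewrite vecZ vecD rscale0l mul1r mul0r !addr0 add0r.
  rewrite lformD lform_side1 add0r lformZ (skew_mulf_eq0 D_field) negb_or a0 andbT.
  exact: (side_off V_td V_emb s3 s1 (nesym n13) v30 V3 z3).
- have -> : w = vec g a a + rscale (vec 0 0 1) (1 - a).
    by rewrite vecZ vecD rscale0l mul1r mul0r !addr0 addrC subrK.
  rewrite lformD lform_side2 add0r lformZ (skew_mulf_eq0 D_field) negb_or.
  rewrite subr_eq0 (eq_sym 1) a1 andbT.
  exact: (side_off V_td V_emb s1 s2 n12 v10 V1 z1).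
- have -> : w = vec g a 0 + vec 0 0 1 by rewrite vecD !addr0 add0r.
  rewrite lformD lform_side3 add0r.
  exact: (side_off V_td V_emb s1 s3 n13 v10 V1 z1).
Qed.

(** [k] is chosen so that w = (h, 0, 1)(1 - a) + (h + k, 1, 1) a, that is, k a = g - h. The
    difference of the two vectors is (k, 1, 0), which gives the third point of the block. *)
Lemma converse_block h : G h -> let k := rscale (g - h) a^-1 in
  exists b, [/\ B b, ell b (ray w), b (hcoord M h 0 1), b (hcoord M (h + k) 1 1)
              & b (hcoord M k 1 0)].
Proof.
move=> Gh k; have Gk : G k by apply: GV; apply: zmodB.
have [f1h Vh] : (zeros f1 `&` V) (hcoord M h 0 1).
  by rewrite (ag_H1 G_assoc); exists h.
have [f2h Vk] : (zeros f2 `&` V) (hcoord M (h + k) 1 1).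
  by rewrite (ag_H2 G_assoc); exists (h + k) => //; apply: zmodD.
have [n12 _ _] := sides_neq V_emb.
have [b Bb [b1 b2]] := block_through V_td V_emb s1 s2 n12 Vh Vk f1h f2h.
have [_ b_sub] := block_line V_emb Bb.
exists b; split=> //.
  apply: (block_combo V_emb (a := 1 - a) (c := a) Bb (b_sub _ b1) (b_sub _ b2)) => //.
  rewrite !vecZ vecD mul0r !mul1r add0r subrK rscaleDr rscale1 rscaleNr rscaleDl.
  by rewrite rscaleVK // addrA subrK addrC subrK.
have k0 : vec k 1 0 != 0 by apply: vec_neq0; rewrite oner_neq0.
apply: (block_ray D_field V_td V_emb Bb s3) => //; first exact: lform_side3.
apply: (block_combo V_emb (a := -1) (c := 1) Bb (b_sub _ b1) (b_sub _ b2)) => //.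
rewrite !vecZ vecD rscaleNr !rscale1 mul0r !mul1r add0r addNr.
by rewrite addrA addNr add0r.
Qed.

Lemma converse_cover p : V p -> exists b, [/\ B b, ell b (ray w) & b p].
Proof.
move=> Vp; have [f sf fp] := in_side V_td V_emb Vp.
case: sf fp => -> fp.
- have : (zeros f1 `&` V) p by [].
  rewrite (ag_H1 G_assoc) => -[h Gh <-].
  by have [b [Bb bw bh _ _]] := converse_block Gh; exists b.
- have : (zeros f2 `&` V) p by [].
  rewrite (ag_H2 G_assoc) => -[h Gh <-].
  have a10 : a - 1 != 0 by rewrite subr_eq0.
  (* Solves h1 + (g - h1) a^-1 = h, that is, h1 (a - 1) = h a - g. *)
  pose h1 := rscale (rscale h a - g) (a - 1)^-1.
  have Gh1 : G h1.
    have Ga1 := stabilizerB G_zmod Ga (@stabilizer1 _ _ G).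
    apply: (stabilizerV D_field G_zmod G_finite Ga1).
    by apply: (zmodB G_zmod) => //; apply: Ga.
  have [b [Bb bw _ bh _]] := converse_block Gh1; exists b; split=> //.
  suff <- : h1 + rscale (g - h1) a^-1 = h by [].
  rewrite -[LHS](rscaleK D_field _ a0) -[RHS](rscaleK D_field _ a0).
  congr (rscale _ _); rewrite rscaleDl rscaleVK // addrCA.
  have -> : rscale h1 a - h1 = rscale h1 (a - 1) by rewrite rscaleDr rscaleNr rscale1.
  by rewrite rscaleVK // addrC subrK.
- have : (zeros f3 `&` V) p by [].
  rewrite (ag_H3 G_assoc) => -[h Gh <-].
  (* The point of H_3 has first entry -h, so the block must start at the solution of (g - h1) a^-1 =
     -h. *)
  have Gh1 : G (rscale h a + g) by apply: zmodD => //; apply: Ga.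
  have [b [Bb bw _ _ bh]] := converse_block Gh1; exists b; split=> //.
  suff <- : rscale (g - (rscale h a + g)) a^-1 = - h by [].
  by rewrite opprD addrCA subrr addr0 rscaleNl rscaleK.
Qed.

Lemma converse_transversal : transversal_point n V B ell (hcoord M g a 1).
Proof.
split; first exact: points_ray.
pose C := [set b | B b /\ ell b (ray w)].
(* Both lines join [p] to [w], which differ because [w] is off every side; hence the lines agree,
   and distinct blocks have distinct lines. *)
have C_inj b c p : C b -> C c -> b p -> c p -> b = c.
  move=> [Bb bw] [Bc cw] bp cp; have Vp := block_sub V_td Bb bp.
  have [lb b_sub] := block_line V_emb Bb; have [lc c_sub] := block_line V_emb Bc.
  apply: (emb_line_distinct V_emb); rewrite ?in_setE //.
  have [v v0 pv] := V_ray V_emb Vp; rewrite {}pv in Vp bp cp.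
  have vw : ray v <> ray w.
    have [f sf fv] := in_side V_td V_emb Vp.
    move=> E; rewrite E in fv; have := converse_off sf.
    by move/zeros_ray: fv => -> //; rewrite eqxx.
  rewrite (line_join D_field lb v0 w0 (b_sub _ bp) bw vw).
  by rewrite (line_join D_field lc v0 w0 (c_sub _ cp) cw vw).
exists C; split=> [b []//||| b []//].
  (* To count [C], each point of [V] on H_1 is sent to the block of [C] through it. This is a
     bijection, and the default [set0] is never returned on [V]. *)
  have <- : [set xget set0 [set b | C b /\ b p] | p in V `&` zeros f1] = C.
    have getP p : V p -> C (xget set0 [set b | C b /\ b p]) /\
        xget set0 [set b | C b /\ b p] p.
      move=> Vp; have [b [Bb bw bp]] := converse_cover Vp.
      by apply: (@xgetI _ set0 [set b | C b /\ b p] b).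
    apply/seteqP; split=> [_ [p [Vp _] <-]|b Cb]; first by have [] := getP _ Vp.
    have [p bp f1p] := block_meets V_td V_emb Cb.1 s1.
    have Vp := block_sub V_td Cb.1 bp; have [Cc cp] := getP _ Vp.
    by exists p => //; apply: C_inj cp bp.
  apply: card_eq_trans (card_side V_td V_emb s1).
  apply: inj_card_eq => p q; rewrite !in_setE => -[Vp f1p] [Vq f1q] pq.
  have [b [Bb bw bp]] := converse_cover Vp; have [c [Bc cw cq]] := converse_cover Vq.
  have [Cx xp] := @xgetI _ set0 [set b | C b /\ b p] b (conj (conj Bb bw) bp).
  have [_ yq] := @xgetI _ set0 [set b | C b /\ b q] c (conj (conj Bc cw) cq).
  rewrite -pq in yq; exact: (block_side_inj V_td V_emb Cx.1 s1 xp yq f1p f1q).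
split=> [|b c Cb Cc [p [bp cp]]|b [Bb _]].
- apply/seteqP; split=> [p [b [Bb _] bp]|p Vp]; first exact: (block_sub V_td Bb bp).
  by have [b [Bb bw bp]] := converse_cover Vp; exists b.
- exact: C_inj bp cp.
- by have [p bp _] := block_meets V_td V_emb Bb s1; exists p.
Qed.

End Converse.

(** A transversal point provides the multipliers 0, 1, a; conversely, one of three distinct
    multipliers is neither 0 nor 1, and [0, a, 1] is then transversal. *)
Lemma transversal_existence :
  (exists q, transversal_point n V B ell q) <-> `I_3 #<= stabilizer_field G.
Proof.
split=> [[q /transversal_coordinates[g [a [Gg Ga a0 a1 _]]]]|].
  apply/card_ge3P; exists 0, 1, a; split; first exact: stabilizer0.
  - exact: stabilizer1.
  - by [].
  - by split; [apply/eqP; rewrite eq_sym oner_neq0 | exact: nesym | exact: nesym].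
move=> /card_ge3P[x [y [z [Gx Gy Gz [xy xz yz]]]]].
have [a Ga [a0 a1]] : exists2 a, stabilizer_field G a & a <> 0 /\ a <> 1.
  have [x0|x0] := pselect (x = 0); have [x1|x1] := pselect (x = 1);
  have [y0|y0] := pselect (y = 0); have [y1|y1] := pselect (y = 1);
  solve [by exists x | by exists y | by exists z => //; split; congruence].
exists (hcoord M 0 a 1).
by apply: converse_transversal => //; [apply: zmod0 | apply/eqP | apply/eqP].
Qed.

End TransversalCoordinates.

(** * Normalisation of the forms and assembly *)

Lemma flat_hyperplanes (D : unitRingType) (D_field : GRing.field_axiom D)
    (d n : nat) (V : set (pspace D d.+2)) (P B : set (set (pspace D d.+2)))
    (ell : set (pspace D d.+2) -> set (pspace D d.+2)) (f1 f2 f3 : 'rV[D]_d.+3) q :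
  transversal_design 3 n V P B ->
  embedded V P B ell (zeros f1) (zeros f2) (zeros f3) ->
  proper_embedding V -> transversal_point n V B ell q ->
  flat d (zeros f1 `&` zeros f2 `&` zeros f3).
Proof.
move=> V_td V_emb V_proper; case: (pselect (points q)) => [[w w0 ->]|nq [/nq //]].
move=> tw; have off f := transversal_off D_field V_td V_emb w0 tw (f := f).
have w1 : lform f1 w != 0 by apply: off; constructor 1.
have w2 : lform f2 w != 0 by apply: off; constructor 2.
have w3 : lform f3 w != 0 by apply: off; constructor 3.
(* Each form is rescaled to take the value 1 at [w], which leaves its zero set unchanged. *)
have norm f : lform f w != 0 -> lform ((lform f w)^-1 *: f) w = 1.
  by move=> fw; rewrite lformZl mulVr //; apply: D_field.
have scale f : lform f w != 0 -> zeros f = zeros ((lform f w)^-1 *: f).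
  by move=> fw; rewrite zeros_scale // invr_eq0.
rewrite (scale _ w1) (scale _ w2) (scale _ w3) in V_emb *.
exact: (flat_sides D_field V_td V_emb w0 tw (norm _ w1) (norm _ w2) (norm _ w3)).
Qed.

Theorem theorem15 (D : unitRingType) (D_skew_field : GRing.field_axiom D)
    (d n : nat) (d_ge2 : (2 <= d)%N)
    (V : set (pspace D d)) (P B : set (set (pspace D d)))
    (ell : set (pspace D d) -> set (pspace D d))
    (H1 H2 H3 : set (pspace D d))
    (V_td : transversal_design 3 n V P B)
    (V_emb : embedded V P B ell H1 H2 H3) :
  [/\ (* a transversal point of a proper embedding *)
      proper_embedding V -> forall q, transversal_point n V B ell q ->
        flat (d - 2)%N (H1 `&` H2 `&` H3) /\
        forall M G, adapted V B H1 H2 H3 M ->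
          associated_group n V H1 H2 H3 M G ->
          (exists g a, [/\ G g, stabilizer_field G a, a <> 0, a <> 1
                         & q = hcoord M g a 1]) /\
          (exists a, [/\ stabilizer_field G a, a <> 0, a <> 1,
                         hyperplane (hyperplane_ratio M a)
                       & hyperplane_ratio M a q]),
      (* converse *)
      proper_embedding V -> flat (d - 2)%N (H1 `&` H2 `&` H3) ->
        forall M G, adapted V B H1 H2 H3 M ->
          associated_group n V H1 H2 H3 M G ->
          forall g a, G g -> stabilizer_field G a -> a <> 0 -> a <> 1 ->
            transversal_point n V B ell (hcoord M g a 1)
    & (* existence of a transversal point, properness not assumed *)
      flat (d - 2)%N (H1 `&` H2 `&` H3) ->
        forall M G, adapted V B H1 H2 H3 M ->
          associated_group n V H1 H2 H3 M G ->
          ((exists q, transversal_point n V B ell q) <->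
           `I_3 #<= stabilizer_field G)].
Proof.
case: d d_ge2 V P B ell H1 H2 H3 V_td V_emb => [|[|d]] // _ V P B ell H1 H2 H3.
move=> V_td V_emb; rewrite subn2 /=.
have [h1 h2 h3] := emb_hyperplane V_emb.
(* The results above concern zero sets of linear forms, so each hyperplane is replaced by such a
   set. *)
have [f1 _ E1] := (hyperplaneP D_skew_field _).1 h1.
have [f2 _ E2] := (hyperplaneP D_skew_field _).1 h2.
have [f3 _ E3] := (hyperplaneP D_skew_field _).1 h3.
rewrite {}E1 {}E2 {}E3 in V_emb *.
split=> [V_proper q tq|_ _ M G adM agG g a Gg Ga a0 a1|_ M G adM agG].
- split=> [|M G adM agG].
    exact: (flat_hyperplanes D_skew_field V_td V_emb V_proper tq).
  have [g [a [Gg Ga a0 a1 qE]]] :=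
    transversal_coordinates D_skew_field V_td V_emb adM agG tq.
  split; first by exists g, a.
  have [M_basis _ _] := adM; exists a; split=> //.
    exact: hyperplane_ratio_hyperplane.
  split; first by have [] := tq.
  by exists g, a, 1; rewrite mulr1.
- by apply: (converse_transversal D_skew_field V_td V_emb adM agG) => //; apply/eqP.
- exact: (transversal_existence D_skew_field V_td V_emb adM agG).
Qed.
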